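(* Let $t,r\ge 1$. Let $H$ be a random $r\times t$ complex matrix that is full rank with probability $1$, with $E\|H\|_F^2<\infty$, and with $E|\log\det(H^*H)|<\infty$ if $t\le r$, respectively $E|\log\det(HH^* )|<\infty$ if $t>r$. Let $\hat H$ be any random variable jointly distributed with $H$ (including the no-CSIT case in which $\hat H$ is independent of $H$). Fix a positive definite $r\times r$ matrix $\Sigma_Z$ and a positive semidefinite $t\times t$ matrix $\Sigma_S'$, and for $P>0$ set $\Sigma_S=P\Sigma_S'$. For a positive definite $t\times t$ matrix $\Sigma_X$ define \[ R(\Sigma_X)=E_{\hat H}\Big( E_{H|\hat H}\log\big\{|\Sigma_X|\,|H(\Sigma_X+\Sigma_S)H^*+\Sigma_Z|\big\} - \inf_{W\in\mathbb{C}^{t\times t}} E_{H|\hat H}\log|M(W,H)|\Big), \] \[ M(W,H)=\begin{pmatrix}\Sigma_X+W\Sigma_S W^* & (\Sigma_X+W\Sigma_S)H^*\\ H(\Sigma_X+\Sigma_S W^* ) & H(\Sigma_X+\Sigma_S)H^*+\Sigma_Z\end{pmatrix}, \] and let $R(P)=\sup\{R(\Sigma_X): \Sigma_X\succ 0,\ \mathrm{tr}(\Sigma_X)\le P\}$. Then, with $\mathrm{SNR}=P/|\Sigma_Z|$, \[ \lim_{P\to\infty}\frac{R(P)}{\log \mathrm{SNR}}=\min(t,r), \] i.e. the rate achievable by dirty paper coding over the fading dirty paper channel with no (and hence with partial) CSIT scales optimally as $\min(r,t)\log\mathrm{SNR}$.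
   Context: The $t\times r$ fading dirty paper channel (FDPC) is $Y=H(X+S)+Z$, where $X\sim\mathcal{CN}(0,\Sigma_X)\in\mathbb{C}^t$ is the transmitted signal with power constraint $\mathrm{tr}(\Sigma_X)\le P$, $S\sim\mathcal{CN}(0,\Sigma_S)$ is interference known non-causally at the transmitter but not at the receiver, $Z\sim\mathcal{CN}(0,\Sigma_Z)\in\mathbb{C}^r$ is noise, and $X,S,Z$ are independent. The fading matrix $H$ is known perfectly at the receiver, while the transmitter only knows $\hat H$ (partial CSIT). Dirty paper coding uses the auxiliary random variable $U=X+WS$ with $t\times t$ inflation factor $W$ (chosen as a function of $\hat H$), and $R(\Sigma_X)$ is the resulting achievable rate. $|A|$ denotes determinant and $A^*$ conjugate transpose. *)

(* Defs.v *)
From HB Require Import structures.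
From mathcomp Require Import all_boot all_order all_algebra.
From mathcomp Require Import all_classical all_reals all_analysis.
From mathcomp Require Import complex.
Set Implicit Arguments. Unset Strict Implicit. Unset Printing Implicit Defensive.
Import Order.TTheory GRing.Theory Num.Theory.
Local Open Scope ring_scope.

Section FDPC.
Variable R : realType.
Local Notation C := (R[i]).

Definition ctr (m n : nat) (A : 'M[C]_(m, n)) : 'M[C]_(n, m) :=
  map_mx (@conjc R) A^T.

Definition hermitian (n : nat) (A : 'M[C]_n) : Prop := ctr A = A.

Definition posdef (n : nat) (A : 'M[C]_n) : Prop :=
  hermitian A /\ forall v : 'cV[C]_n, v != 0 -> 0 < (ctr v *m A *m v) 0 0.
Definition psd (n : nat) (A : 'M[C]_n) : Prop :=
  hermitian A /\ forall v : 'cV[C]_n, 0 <= (ctr v *m A *m v) 0 0.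

Definition normF2 (m n : nat) (A : 'M[C]_(m, n)) : R :=
  \sum_(i < m) \sum_(j < n) (complex.Re (A i j) ^+ 2 + complex.Im (A i j) ^+ 2).

(* |A| for a Hermitian matrix (real determinant), and its logarithm *)
Definition rdet (n : nat) (A : 'M[C]_n) : R := complex.Re (\det A).
Definition logdet (n : nat) (A : 'M[C]_n) : R := ln (rdet A).

Definition Mblk (t r : nat) (SX SS W : 'M[C]_t) (SZr : 'M[C]_r)
    (H : 'M[C]_(r, t)) : 'M[C]_(t + r) :=
  block_mx (SX + W *m SS *m ctr W) ((SX + W *m SS) *m ctr H)
           (H *m (SX + SS *m ctr W)) (H *m (SX + SS) *m ctr H + SZr).

End FDPC.

Definition measurable_cmx (R : realType) (d : measure_display)
  (Omega : measurableType d) (m n : nat) (H : Omega -> 'M[R[i]]_(m, n)) : Prop :=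
  forall i j, measurable_fun setT (fun w => complex.Re (H w i j)) /\
              measurable_fun setT (fun w => complex.Im (H w i j)).

Section Rate.
Local Open Scope ereal_scope.
Variables (R : realType) (dT dO : measure_display)
  (T : measurableType dT) (Omega : measurableType dO)
  (mu : probability T R) (kappa : R.-pker T ~> Omega)
  (t r : nat) (H : Omega -> 'M[R[i]]_(r, t))
  (SZ : 'M[R[i]]_r) (SS' : 'M[R[i]]_t).

Definition SigS (P : R) : 'M[R[i]]_t := (P%:C)%C *: SS'.

Definition rateX (P : R) (SX : 'M[R[i]]_t) : \bar R :=
  \int[mu]_h
    ( \int[kappa h]_w
        (ln (rdet SX * rdet (H w *m (SX + SigS P) *m ctr (H w) + SZ)))%:E
      - ereal_inf (range (fun W : 'M[R[i]]_t =>
          \int[kappa h]_w (logdet (Mblk SX (SigS P) W SZ (H w)))%:E)) ).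

Definition rateP (P : R) : \bar R :=
  ereal_sup [set rateX P SX | SX in
    [set SX : 'M[R[i]]_t | posdef SX /\ (complex.Re (\tr SX) <= P)%R]].

End Rate.

(* Main.v *)
(* With W = I the block M(I, H) has determinant |SX + SS| |SZ|, so for
   SX = (P/t) I the rate is at least E ln |H K H^* + SZ| - O(1) with
   K = SX + SS >= (P/t) I.  Writing SZ >= s I and moving the identity from r x r
   to t x t by Sylvester's identity when t <= r, this determinant is at least a
   constant times P^min(t,r) times the Gram determinant of H, whose logarithm is
   integrable.  Conversely M(W, H) is congruent, by a unitriangular matrix, to
   diag(SX, SZ) plus a positive semidefinite matrix, so |M(W, H)| >= |SX| |SZ|
   for every W; the rate is then at most E ln (|H K H^* + SZ| / |SZ|), and the
   same identity bounds this by min(t,r) ln P + O(1 + E ||H||^2).  Hence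
   R(P) - min(t,r) ln P stays bounded.

   Measurability in h of the infimum over W is not needed: both bounds on the
   integrand are measurable, and the integral is monotone on arbitrary
   functions. *)

Require Import Defs.
From mathcomp Require Import all_boot all_order all_algebra.
From mathcomp Require Import all_classical all_reals all_analysis.
From mathcomp Require Import complex spectral measurable_realfun.
From mathcomp Require Import ring lra.
Set Implicit Arguments. Unset Strict Implicit. Unset Printing Implicit Defensive.
Import Order.TTheory GRing.Theory Num.Theory.
Import numFieldNormedType.Exports.
Local Open Scope classical_set_scope.
Local Open Scope ring_scope.

(** * Hermitian matrices *)

Section HermitianMatrices.
Variable R : realType.
Local Notation C := R[i].

Lemma ctrK m n (A : 'M[C]_(m, n)) : ctr (ctr A) = A.
Proof. exact: trmxCK. Qed.

Lemma ctrM m n p (A : 'M[C]_(m, n)) (B : 'M[C]_(n, p)) :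
  ctr (A *m B) = ctr B *m ctr A.
Proof. by rewrite /ctr trmx_mul map_mxM. Qed.

Lemma ctrD m n (A B : 'M[C]_(m, n)) : ctr (A + B) = ctr A + ctr B.
Proof. by rewrite /ctr raddfD map_mxD. Qed.

Lemma ctrZ m n (a : R) (A : 'M[C]_(m, n)) :
  ctr ((a%:C)%C *: A) = (a%:C)%C *: ctr A.
Proof. by rewrite /ctr linearZ /= map_mxZ; congr (_ *: _); exact: conjc_real. Qed.

Lemma ctr_scalar n (a : R) :
  ctr ((a%:C)%C%:M : 'M[C]_n) = (a%:C)%C%:M.
Proof. by rewrite /ctr tr_scalar_mx map_scalar_mx /= oppr0. Qed.

Lemma ctr1 n : ctr (1%:M : 'M[C]_n) = 1%:M.
Proof. by rewrite /ctr trmx1 map_mx1. Qed.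

Lemma ctr0 m n : ctr (0 : 'M[C]_(m, n)) = 0.
Proof. by rewrite /ctr trmx0 map_mx0. Qed.

Lemma ctr_diag n (d : 'I_n -> R) :
  ctr (diag_mx (\row_i ((d i)%:C)%C)) = diag_mx (\row_i ((d i)%:C)%C).
Proof.
rewrite /ctr tr_diag_mx map_diag_mx; congr diag_mx.
by apply/rowP => i; rewrite !mxE; exact: conjc_real.
Qed.

Lemma det_ctr n (A : 'M[C]_n) : \det (ctr A) = conjc (\det A).
Proof. by rewrite /ctr det_map_mx det_tr. Qed.

Lemma ctr_block m1 m2 n1 n2 (A : 'M[C]_(m1, n1)) (B : 'M[C]_(m1, n2))
    (D : 'M[C]_(m2, n1)) (E : 'M[C]_(m2, n2)) :
  ctr (block_mx A B D E) = block_mx (ctr A) (ctr D) (ctr B) (ctr E).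
Proof. by rewrite /ctr tr_block_mx map_block_mx. Qed.

Lemma ctr_col_mx m1 m2 n (A : 'M[C]_(m1, n)) (B : 'M[C]_(m2, n)) :
  ctr (col_mx A B) = row_mx (ctr A) (ctr B).
Proof. by rewrite /ctr tr_col_mx map_row_mx. Qed.

Lemma mulconjc_ge0 (z : C) : 0 <= conjc z * z.
Proof. by rewrite mulrC; exact: mul_conjC_ge0. Qed.

Lemma sqnorm_cV n (v : 'cV[C]_n) :
  (ctr v *m v) 0 0 = \sum_i (conjc (v i 0) * v i 0).
Proof. by rewrite mxE; apply: eq_bigr => i _; rewrite !mxE. Qed.

Lemma sqnorm_cV_ge0 n (v : 'cV[C]_n) : 0 <= (ctr v *m v) 0 0.
Proof. by rewrite sqnorm_cV sumr_ge0// => i _; exact: mulconjc_ge0. Qed.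

Lemma sqnorm_cV_gt0 n (v : 'cV[C]_n) : v != 0 -> 0 < (ctr v *m v) 0 0.
Proof.
move=> v0; rewrite lt_def sqnorm_cV_ge0 andbT; apply: contra v0.
rewrite sqnorm_cV psumr_eq0; last by move=> i _; exact: mulconjc_ge0.
move=> /allP h; apply/eqP/colP => i; rewrite mxE.
have := h i (mem_index_enum i); rewrite mulf_eq0.
by rewrite conjc_eq0 orbb => /eqP.
Qed.

Lemma psd_gram m n (G : 'M[C]_(m, n)) : psd (G *m ctr G).
Proof.
split; first by rewrite /Defs.hermitian ctrM ctrK.
move=> v; have -> : ctr v *m (G *m ctr G) *m v = ctr (ctr G *m v) *m (ctr G *m v).
  by rewrite ctrM ctrK !mulmxA.
exact: sqnorm_cV_ge0.
Qed.

Lemma posdef_gram m n (G : 'M[C]_(m, n)) : row_free G -> posdef (G *m ctr G).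
Proof.
move=> Gfree; split; first by rewrite /Defs.hermitian ctrM ctrK.
move=> v v0; have -> : ctr v *m (G *m ctr G) *m v = ctr (ctr G *m v) *m (ctr G *m v).
  by rewrite ctrM ctrK !mulmxA.
(* Taking adjoints turns [ctr G *m v = 0] into [ctr v *m G = 0], the side on which row freeness
   cancels [G]. *)
apply: sqnorm_cV_gt0; apply: contra v0 => /eqP/(congr1 (@ctr R _ _)).
rewrite ctrM ctrK ctr0 => /eqP; rewrite mulmx_free_eq0// => /eqP.
by move=> /(congr1 (@ctr R _ _)); rewrite ctrK ctr0 => ->.
Qed.

Lemma posdef_psd n (A : 'M[C]_n) : posdef A -> psd A.
Proof.
move=> [hA pA]; split=> // v; have [->|v0] := eqVneq v 0.
  by rewrite mulmx0 mxE.
exact/ltW/pA.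
Qed.

Lemma psdD n (A B : 'M[C]_n) : psd A -> psd B -> psd (A + B).
Proof.
move=> [hA pA] [hB pB]; split; first by rewrite /Defs.hermitian ctrD hA hB.
by move=> v; rewrite mulmxDr mulmxDl mxE addr_ge0.
Qed.

Lemma posdefD n (A B : 'M[C]_n) : posdef A -> psd B -> posdef (A + B).
Proof.
move=> [hA pA] [hB pB]; split; first by rewrite /Defs.hermitian ctrD hA hB.
by move=> v v0; rewrite mulmxDr mulmxDl mxE ltr_wpDr// pA.
Qed.

Lemma psdZ n (a : R) (A : 'M[C]_n) : 0 <= a -> psd A -> psd ((a%:C)%C *: A).
Proof.
move=> a0 [hA pA]; split; first by rewrite /Defs.hermitian ctrZ hA.
by move=> v; rewrite -scalemxAr -scalemxAl mxE mulr_ge0// lecR.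
Qed.

Lemma psd_scalar n (a : R) : 0 <= a -> psd ((a%:C)%C%:M : 'M[C]_n).
Proof.
move=> a0; rewrite -scalemx1; apply: psdZ => //.
by have := psd_gram (1%:M : 'M[C]_n); rewrite ctr1 mulmx1.
Qed.

Lemma posdef_scalar n (a : R) : 0 < a -> posdef ((a%:C)%C%:M : 'M[C]_n).
Proof.
move=> a0; split; first exact: ctr_scalar.
move=> v v0; rewrite mul_mx_scalar -scalemxAl mxE mulr_gt0 ?ltcR//.
exact: sqnorm_cV_gt0.
Qed.

(** The spectral theorem for normal matrices, with the eigenvalues turned into elements of [R] so
    that later sign conditions and sums are about reals. *)
Lemma hermitian_spectral n (A : 'M[C]_n) : Defs.hermitian A ->
  exists U (d : 'I_n -> R), [/\ U *m ctr U = 1%:M, ctr U *m U = 1%:M &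
    A = ctr U *m diag_mx (\row_i ((d i)%:C)%C) *m U].
Proof.
move=> hA.
have Ah : A \is hermsymmx by apply/is_hermitianmxP; rewrite expr0 scale1r.
have Uu := spectral_unitarymx A.
have UU : spectralmx A *m ctr (spectralmx A) = 1%:M by exact/unitarymxP.
exists (spectralmx A), (fun i => complex.Re (spectral_diag A 0 i)); split => //.
  exact: mulmx1C.
have /orthomx_spectralP := hermitian_normalmx Ah.
rewrite (invmx_unitary Uu) => AE; rewrite [LHS]AE.
congr (_ *m _ *m _); congr diag_mx; apply/rowP => i; rewrite !mxE.
have /mxOverP/(_ 0 i) := hermitian_spectral_diag_real Ah.
by move=> /complex_realP[k ->].
Qed.

(** Here [v] is the unit eigenvector for [d i]; evaluating the form at it transfers
    (semi)definiteness to the eigenvalues. *)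
Lemma spectral_form n (U : 'M[C]_n) (d : 'I_n -> R) i : U *m ctr U = 1%:M ->
  let v : 'cV[C]_n := ctr U *m delta_mx i 0 in v != 0 /\
  (ctr v *m (ctr U *m diag_mx (\row_i ((d i)%:C)%C) *m U) *m v) 0 0
    = ((d i)%:C)%C.
Proof.
move=> UU v; have Uv : U *m v = delta_mx i 0 by rewrite /v mulmxA UU mul1mx.
split.
  apply/eqP => v0; have := Uv; rewrite v0 mulmx0 => /matrixP/(_ i 0).
  by rewrite !mxE !eqxx => /eqP; rewrite eq_sym oner_eq0.
have -> : ctr v *m (ctr U *m diag_mx (\row_i ((d i)%:C)%C) *m U) *m v =
          ctr (U *m v) *m diag_mx (\row_i ((d i)%:C)%C) *m (U *m v).
  by rewrite ctrM !mulmxA.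
rewrite Uv mxE (bigD1 i)//= big1 ?addr0; last first.
  by move=> j ji; rewrite [X in _ * X]mxE (negbTE ji) mulr0.
rewrite [X in _ * X]mxE !eqxx mulr1 mul_mx_diag !mxE !eqxx /=.
by rewrite oppr0 mul1r.
Qed.

Lemma psd_spectral n (A : 'M[C]_n) : psd A ->
  exists U (d : 'I_n -> R), [/\ U *m ctr U = 1%:M, ctr U *m U = 1%:M,
    (forall i, 0 <= d i) &
    A = ctr U *m diag_mx (\row_i ((d i)%:C)%C) *m U].
Proof.
move=> [hA pA]; have [U [d [UU UU' AE]]] := hermitian_spectral hA.
exists U, d; split=> // i; have [_ h] := spectral_form d i UU.
by rewrite -lecR -h -AE pA.
Qed.

Lemma psd_unitary_diag n (U : 'M[C]_n) (d : 'I_n -> R) : (forall i, 0 <= d i) ->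
  psd (ctr U *m diag_mx (\row_i ((d i)%:C)%C) *m U).
Proof.
move=> d0; have -> : diag_mx (\row_i ((d i)%:C)%C) =
   diag_mx (\row_i ((Num.sqrt (d i))%:C)%C) *m
     ctr (diag_mx (\row_i ((Num.sqrt (d i))%:C)%C)) :> 'M[C]_n.
  rewrite ctr_diag mulmx_diag; congr diag_mx; apply/rowP => i.
  by rewrite !mxE -rmorphM -expr2 sqr_sqrtr.
rewrite mulmxA -[_ *m U]mulmxA; set E := diag_mx _.
rewrite -[X in _ *m X](_ : ctr (ctr U *m E) = _).
  exact: psd_gram.
by rewrite ctrM ctrK.
Qed.

Lemma psd_gramP n (A : 'M[C]_n) : psd A -> exists G : 'M[C]_n, A = G *m ctr G.
Proof.
move=> /psd_spectral[U [d [UU _ d0 ->]]].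
(* A factor with the square roots of the eigenvalues on the diagonal; it need not be Hermitian. *)
exists (ctr U *m diag_mx (\row_i ((Num.sqrt (d i))%:C)%C)).
rewrite ctrM ctrK ctr_diag !mulmxA; congr (_ *m _); rewrite -mulmxA.
congr (_ *m _); rewrite mulmx_diag; congr diag_mx; apply/rowP => i.
by rewrite !mxE -rmorphM -expr2 sqr_sqrtr.
Qed.

Lemma psd_congr m n (B : 'M[C]_(m, n)) (A : 'M[C]_n) :
  psd A -> psd (B *m A *m ctr B).
Proof.
move=> /psd_gramP[G ->].
have -> : B *m (G *m ctr G) *m ctr B = (B *m G) *m ctr (B *m G).
  by rewrite ctrM !mulmxA.
exact: psd_gram.
Qed.

Lemma posdef_det_gt0 n (A : 'M[C]_n) : posdef A -> 0 < \det A.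
Proof.
move=> [hA pA]; have [U [d [UU UU' AE]]] := hermitian_spectral hA.
have dU : \det (ctr U) * \det U = 1 by rewrite -det_mulmx UU' det1.
rewrite AE !det_mulmx mulrAC dU mul1r det_diag prodr_gt0// => i _.
have [v0 h] := spectral_form d i UU.
by rewrite mxE -h -AE pA.
Qed.

(** The eigenvalues are [1 + d i] with [d i] nonnegative, so their product is at least 1. *)
Lemma det_add1_psd_ge1 n (N : 'M[C]_n) : psd N -> 1 <= \det (1%:M + N).
Proof.
move=> /psd_spectral[U [d [UU UU' d0 NE]]].
have -> : 1%:M + N = ctr U *m diag_mx (\row_i ((1 + d i)%:C)%C) *m U.
  have -> : diag_mx (\row_i ((1 + d i)%:C)%C) =
            1%:M + diag_mx (\row_i ((d i)%:C)%C) :> 'M[C]_n.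
    rewrite -diag_const_mx -raddfD; congr diag_mx; apply/rowP => i.
    by rewrite !mxE rmorphD.
  by rewrite mulmxDr mulmx1 mulmxDl UU' -NE.
have dU : \det (ctr U) * \det U = 1 by rewrite -det_mulmx UU' det1.
rewrite !det_mulmx mulrAC dU mul1r det_diag.
elim/big_rec: _ => // i x _ x1; apply: mulr_ege1 => //.
by rewrite mxE -[1]/((1:R)%:C)%C lecR lerDl d0.
Qed.

Lemma posdef_gram_unit n (A : 'M[C]_n) : posdef A ->
  exists2 G : 'M[C]_n, A = G *m ctr G & G \in unitmx.
Proof.
move=> pA; have [G AE] := psd_gramP (posdef_psd pA); exists G => //.
have := posdef_det_gt0 pA; rewrite AE det_mulmx unitmxE unitfE.
by apply: contraTneq => ->; rewrite mul0r ltxx.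
Qed.

(** Pulling [G] out on the left and [ctr G] on the right leaves the identity plus a congruence of
    [N], whose determinant is at least 1. *)
Lemma det_gram_addpsd n (G N : 'M[C]_n) : G \in unitmx -> psd N ->
  \det (G *m ctr G) <= \det (G *m ctr G + N).
Proof.
move=> Gu pN; have := Gu; rewrite unitmxE unitfE => dG0.
have -> : G *m ctr G + N =
    G *m (1%:M + invmx G *m N *m ctr (invmx G)) *m ctr G.
  have GG : ctr (invmx G) *m ctr G = 1%:M by rewrite -ctrM mulmxV ?ctr1.
  rewrite mulmxDr mulmx1 mulmxDl !mulmxA mulmxV// mul1mx.
  by rewrite -(mulmxA N) GG mulmx1.
rewrite !det_mulmx mulrAC; set x := \det _ * \det (ctr _).
rewrite ler_peMr ?det_add1_psd_ge1//; last exact: psd_congr.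
by rewrite /x det_ctr; exact: mul_conjC_ge0.
Qed.

Lemma posdef_det_mono n (A B : 'M[C]_n) : posdef A -> psd (B - A) ->
  \det A <= \det B.
Proof.
move=> /posdef_gram_unit[G -> Gu] /(det_gram_addpsd Gu).
by rewrite addrC subrK.
Qed.

(** The trace is the sum of nonnegative eigenvalues, hence dominates each of them. *)
Lemma psd_le_trace n (A : 'M[C]_n) : psd A ->
  psd (((complex.Re (\tr A))%:C)%C%:M - A) /\ 0 <= complex.Re (\tr A).
Proof.
move=> /psd_spectral[U [d [UU UU' d0 AE]]].
have trE : \tr A = ((\sum_i d i)%:C)%C.
  rewrite AE mxtrace_mulC mulmxA UU mul1mx mxtrace_diag rmorph_sum.
  by apply: eq_bigr => i _; rewrite mxE.
rewrite trE /=; split; last by rewrite sumr_ge0.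
have -> : (((\sum_i d i)%:C)%C%:M : 'M[C]_n) - A =
   ctr U *m diag_mx (\row_i ((\sum_i d i - d i)%:C)%C) *m U.
  have -> : diag_mx (\row_i ((\sum_i d i - d i)%:C)%C) =
      ((\sum_i d i)%:C)%C%:M - diag_mx (\row_i ((d i)%:C)%C) :> 'M[C]_n.
    rewrite -diag_const_mx -raddfB; congr diag_mx; apply/rowP => i.
    by rewrite !mxE rmorphB.
  rewrite mulmxBr mulmxBl -AE; congr (_ - _).
  by rewrite mul_mx_scalar -scalemxAl UU' scalemx1.
apply: psd_unitary_diag => i; rewrite (bigD1 i)//= addrAC subrr add0r.
by rewrite sumr_ge0.
Qed.

Lemma posdef_ge_scalar n (A : 'M[C]_n) : posdef A ->
  exists2 s : R, 0 < s & psd (A - (s%:C)%C%:M).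
Proof.
move=> [hA pA]; have [U [d [UU UU' AE]]] := hermitian_spectral hA.
have d0 i : 0 < d i.
  have [v0 h] := spectral_form d i UU.
  by rewrite -ltcR -h -AE pA.
have sum0 (Q : pred 'I_n) : 0 <= \sum_(i | Q i) (d i)^-1.
  by rewrite sumr_ge0// => i _; rewrite invr_ge0 ltW.
(* A positive lower bound on all eigenvalues that avoids taking a minimum; the added 1 keeps it
   positive when [n = 0]. *)
pose s := (1 + \sum_i (d i)^-1)^-1.
exists s; first by rewrite invr_gt0 ltr_pwDl.
have -> : A - (s%:C)%C%:M = ctr U *m diag_mx (\row_i ((d i - s)%:C)%C) *m U.
  have -> : diag_mx (\row_i ((d i - s)%:C)%C) =
      diag_mx (\row_i ((d i)%:C)%C) - (s%:C)%C%:M :> 'M[C]_n.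
    rewrite -diag_const_mx -raddfB; congr diag_mx; apply/rowP => i.
    by rewrite !mxE rmorphB.
  rewrite mulmxBr mulmxBl -AE; congr (_ - _).
  by rewrite mul_mx_scalar -scalemxAl UU' scalemx1.
apply: psd_unitary_diag => i; rewrite subr_ge0 /s -[leRHS]invrK.
rewrite lef_pV2 ?posrE ?invr_gt0 ?ltr_pwDl// (bigD1 i)//= addrCA lerDl.
by rewrite addr_ge0.
Qed.

(** Sylvester's identity, with powers of [s] on both sides instead of a division. The block matrix
    [M] is made triangular in two ways: by a left multiplication, giving the first determinant, and
    by a right one, giving the second. *)
Lemma det_scalarD_mulC (F : comNzRingType) m n (s : F) (A : 'M[F]_(m, n))
    (B : 'M[F]_(n, m)) :
  \det (s%:M + A *m B) * s ^+ n = s ^+ m * \det (s%:M + B *m A).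
Proof.
pose M := block_mx (s%:M : 'M[F]_m) (- A) B (1%:M : 'M[F]_n).
have dM : \det M = \det (s%:M + A *m B).
  have := det_mulmx (block_mx (1%:M : 'M[F]_m) A 0 1%:M) M.
  rewrite mulmx_block !mul1mx !mul0mx !add0r det_ublock mulmx1 addNr.
  by rewrite det_lblock !det1 !mulr1 mul1r => <-.
have := det_mulmx M (block_mx (1%:M : 'M[F]_m) A 0 s%:M).
rewrite mulmx_block !mulmx1 !mulmx0 !addr0 mulNmx mul_scalar_mx mul_mx_scalar.
rewrite subrr mul1mx det_lblock det_ublock det1 mul1r !det_scalar dM => <-.
by rewrite [X in \det X]addrC.
Qed.
End HermitianMatrices.

(** * Determinant bounds *)

Section DeterminantBounds.
Variable R : realType.
Local Notation C := R[i].

(** Positivity in the order of [C] forces a zero imaginary part, so [rdet] loses nothing on positive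
    definite matrices. *)
Lemma posdef_detE n (A : 'M[C]_n) : posdef A ->
  0 < rdet A /\ \det A = ((rdet A)%:C)%C.
Proof.
move=> /posdef_det_gt0; rewrite /rdet ltcE /= => /andP[/eqP dI dR]; split=> //.
by apply/eqP; rewrite eq_complex /= dI !eqxx.
Qed.

Lemma rdet_mono n (A B : 'M[C]_n) : posdef A -> psd (B - A) ->
  rdet A <= rdet B.
Proof.
by move=> pA pBA; have := posdef_det_mono pA pBA; rewrite lecE => /andP[].
Qed.

Lemma rdetZ n (a : R) (A : 'M[C]_n) : rdet ((a%:C)%C *: A) = a ^+ n * rdet A.
Proof. by rewrite /rdet detZ -rmorphXn; case: (\det A) => x y /=; rewrite mul0r subr0. Qed.

Lemma rdet_scalar n (a : R) : rdet ((a%:C)%C%:M : 'M[C]_n) = a ^+ n.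
Proof. by rewrite -scalemx1 rdetZ /rdet det1 mulr1. Qed.

(** [Mblk] is the covariance of (U, Y): the pair (X, Z) enters through the unitriangular [L], and S
    through [col_mx W H]. Dropping the contribution of S can only lower the determinant. *)
Lemma Mblk_rdet_ge t r (SX SS W : 'M[C]_t) (SZ : 'M[C]_r) (H : 'M[C]_(r, t)) :
  posdef SX -> psd SS -> posdef SZ ->
  rdet SX * rdet SZ <= rdet (Mblk SX SS W SZ H).
Proof.
move=> pX pS pZ.
have [_ dX] := posdef_detE pX; have [_ dZ] := posdef_detE pZ.
have [G GE Gu] := posdef_gram_unit pX; have [F FE Fu] := posdef_gram_unit pZ.
pose L : 'M[C]_(t + r) := block_mx 1%:M 0 H 1%:M.
(* [V] is [col_mx W H] with [L] undone, so that both contributions share the factor [L]. *)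
pose V : 'M[C]_(t + r, t) := col_mx W (H - H *m W).
pose D : 'M[C]_(t + r) := block_mx G 0 0 F.
have DE : D *m ctr D = block_mx SX 0 0 SZ.
  by rewrite ctr_block !ctr0 mulmx_block !mulmx0 !mul0mx !addr0 add0r GE FE.
have Du : D \in unitmx.
  by rewrite unitmxE det_ublock unitrM -!unitmxE Gu Fu.
have LVE : L *m V = col_mx W H.
  by rewrite mul_block_col mul1mx mul0mx addr0 mul1mx addrC subrK.
have ME : Mblk SX SS W SZ H = L *m (D *m ctr D + V *m SS *m ctr V) *m ctr L.
  rewrite mulmxDr mulmxDl DE.
  have -> : L *m (V *m SS *m ctr V) *m ctr L = col_mx W H *m SS *m row_mx (ctr W) (ctr H).
    by rewrite -ctr_col_mx -LVE ctrM !mulmxA.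
  rewrite (mul_col_mx W H SS) mul_col_row /L ctr_block !ctr1 ctr0.
  rewrite !mulmx_block !mul1mx !mul0mx !mulmx0 !mulmx1 !addr0 !add0r.
  rewrite add_block_mx /Mblk.
  congr block_mx; rewrite ?mulmxDl ?mulmxDr ?mulmxA //.
  by rewrite mulmxDl addrAC.
have dL : \det L = 1 by rewrite det_lblock !det1 mulr1.
have := det_gram_addpsd Du (psd_congr V pS).
have -> : \det (D *m ctr D) = (rdet SX * rdet SZ)%:C%C.
  by rewrite DE det_ublock dX dZ rmorphM.
rewrite /rdet ME !det_mulmx det_ctr dL conjc1 mulr1 mul1r.
by rewrite lecE => /andP[].
Qed.

(** For [W = 1] one has U = X + S and Y = HU + Z, so (U, Y) is a unitriangular image of the
    independent pair (U, Z); the channel drops out of the determinant. *)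
Lemma Mblk1_rdet t r (SX SS : 'M[C]_t) (SZ : 'M[C]_r) (H : 'M[C]_(r, t)) :
  posdef (SX + SS) -> posdef SZ ->
  rdet (Mblk SX SS 1%:M SZ H) = rdet (SX + SS) * rdet SZ.
Proof.
move=> pK pZ; have [_ dK] := posdef_detE pK; have [_ dZ] := posdef_detE pZ.
pose L : 'M[C]_(t + r) := block_mx 1%:M 0 H 1%:M.
have -> : Mblk SX SS 1%:M SZ H = L *m block_mx (SX + SS) 0 0 SZ *m ctr L.
  rewrite /L ctr_block !ctr1 ctr0 !mulmx_block.
  rewrite !mul1mx !mul0mx !mulmx0 !mulmx1 !addr0 !add0r.
  by rewrite /Mblk ctr1 !mulmx1 !mul1mx.
have dL : \det L = 1 by rewrite det_lblock !det1 mulr1.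
by rewrite {1}/rdet !det_mulmx det_ctr dL conjc1 mulr1 mul1r det_ublock dK dZ -rmorphM.
Qed.

Lemma tr_gram_normF2 m n (A : 'M[C]_(m, n)) :
  complex.Re (\tr (A *m ctr A)) = normF2 A.
Proof.
rewrite /normF2 /mxtrace raddf_sum; apply: eq_bigr => i _.
rewrite mxE raddf_sum; apply: eq_bigr => j _; rewrite !mxE.
by case: (A i j) => x y /=; rewrite mulrN opprK !expr2.
Qed.

Lemma normF2_ge0 m n (A : 'M[C]_(m, n)) : 0 <= normF2 A.
Proof. by rewrite -tr_gram_normF2; have [_] := psd_le_trace (psd_gram A). Qed.

Lemma psd_normF2_gram m n (A : 'M[C]_(m, n)) :
  psd (((normF2 A)%:C)%C%:M - A *m ctr A).
Proof.
by rewrite -tr_gram_normF2; have [] := psd_le_trace (psd_gram A).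
Qed.

Lemma psd_normF2_gramC m n (A : 'M[C]_(m, n)) :
  psd (((normF2 A)%:C)%C%:M - ctr A *m A).
Proof.
rewrite -tr_gram_normF2 mxtrace_mulC; have := psd_gram (ctr A).
by rewrite ctrK => /psd_le_trace[].
Qed.

Lemma posdef_gram_scalar m n (a s : R) (A : 'M[C]_(m, n)) : 0 <= a -> 0 < s ->
  posdef ((a%:C)%C *: (A *m ctr A) + (s%:C)%C%:M).
Proof.
move=> a0 s0; rewrite addrC; apply: posdefD; first exact: posdef_scalar.
exact/psdZ/psd_gram.
Qed.

(** Both determinants are real by positive definiteness, so Sylvester's identity descends from [C]
    to [R]. *)
Lemma rdet_gram_mulC r t (a s : R) (H : 'M[C]_(r, t)) : 0 <= a -> 0 < s ->
  rdet ((a%:C)%C *: (H *m ctr H) + (s%:C)%C%:M) * s ^+ t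
  = s ^+ r * rdet ((a%:C)%C *: (ctr H *m H) + (s%:C)%C%:M).
Proof.
move=> a0 s0; have [_ d1] := posdef_detE (posdef_gram_scalar H a0 s0).
have [_] := posdef_detE (posdef_gram_scalar (ctr H) a0 s0); rewrite ctrK => d2.
have := det_scalarD_mulC (s%:C)%C ((a%:C)%C *: H) (ctr H).
rewrite -scalemxAl -scalemxAr ![(s%:C)%C%:M + _]addrC d1 d2 -!rmorphXn -!rmorphM.
by move=> [].
Qed.

Lemma received_posdef r t (K : 'M[C]_t) (SZ : 'M[C]_r) (H : 'M[C]_(r, t)) :
  psd K -> posdef SZ -> posdef (H *m K *m ctr H + SZ).
Proof. by move=> pK pZ; rewrite addrC; apply: posdefD => //; exact: psd_congr. Qed.

(** Replace [K] and [SZ] by their scalar bounds, then bound the Gram matrix of the smaller size by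
    its trace; working in that size produces the exponent [minn t r]. *)
Lemma received_rdet_le r t (k s : R) (K : 'M[C]_t) (SZ : 'M[C]_r)
    (H : 'M[C]_(r, t)) :
  0 <= k -> 0 < s -> psd K -> posdef SZ ->
  psd ((k%:C)%C%:M - K) -> psd ((s%:C)%C%:M - SZ) ->
  rdet (H *m K *m ctr H + SZ)
    <= s ^+ (r - minn t r) * (k * normF2 H + s) ^+ minn t r.
Proof.
move=> k0 s0 pK pZ kK sZ; pose G := (k%:C)%C *: (H *m ctr H) + (s%:C)%C%:M.
have le1 : rdet (H *m K *m ctr H + SZ) <= rdet G.
  apply: rdet_mono; first exact: received_posdef.
  have -> : G - (H *m K *m ctr H + SZ) =
      H *m ((k%:C)%C%:M - K) *m ctr H + ((s%:C)%C%:M - SZ).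
    rewrite /G mulmxBr mulmxBl mul_mx_scalar -scalemxAl.
    by rewrite opprD addrACA.
  exact: psdD (psd_congr H kK) sZ.
have kn_s n : ((k * normF2 H + s)%:C)%C%:M =
    (k%:C)%C *: ((normF2 H)%:C)%C%:M + (s%:C)%C%:M :> 'M[C]_n.
  by rewrite scale_scalar_mx -rmorphM -raddfD -rmorphD.
apply: (le_trans le1); case: (leqP r t) => rt.
  rewrite subnn expr0 mul1r -rdet_scalar.
  apply: rdet_mono; first exact: posdef_gram_scalar.
  rewrite kn_s /G opprD addrACA subrr addr0 -scalerBr; exact/psdZ/psd_normF2_gram.
(* For [t < r], multiplying by [s ^+ t] allows the passage to the [t] by [t] Gram matrix. *)
rewrite -(ler_pM2r (exprn_gt0 t s0)).
rewrite (rdet_gram_mulC H k0 s0) mulrAC -exprD subnK ?(ltnW rt)//.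
rewrite ler_pM2l ?exprn_gt0// -rdet_scalar; apply: rdet_mono.
  by have := posdef_gram_scalar (ctr H) k0 s0; rewrite ctrK.
rewrite kn_s opprD addrACA subrr addr0 -scalerBr; exact/psdZ/psd_normF2_gramC.
Qed.

Lemma received_rdet_ge r t (k s : R) (K : 'M[C]_t) (SZ : 'M[C]_r)
    (H : 'M[C]_(r, t)) :
  0 <= k -> 0 < s -> psd (K - (k%:C)%C%:M) -> psd (SZ - (s%:C)%C%:M) ->
  rdet ((k%:C)%C *: (H *m ctr H) + (s%:C)%C%:M) <= rdet (H *m K *m ctr H + SZ).
Proof.
move=> k0 s0 kK sZ; apply: rdet_mono; first exact: posdef_gram_scalar.
rewrite opprD addrACA; refine (psdD _ sZ).
have -> : (k%:C)%C *: (H *m ctr H) = H *m (k%:C)%C%:M *m ctr H.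
  by rewrite mul_mx_scalar -scalemxAl.
by rewrite -mulmxBl -mulmxBr; exact: psd_congr.
Qed.

Lemma rdet_gram_row_free r t (k s : R) (H : 'M[C]_(r, t)) :
  0 < k -> 0 < s -> row_free H ->
  k ^+ r * rdet (H *m ctr H) <= rdet ((k%:C)%C *: (H *m ctr H) + (s%:C)%C%:M).
Proof.
move=> k0 s0 Hfree; rewrite -rdetZ; apply: rdet_mono; last first.
  by rewrite addrAC subrr add0r; exact/psd_scalar/ltW.
(* Absorbing the square root of [k] into [H] exhibits a Gram matrix of a row-free matrix, hence a
   positive definite one. *)
have -> : (k%:C)%C *: (H *m ctr H) =
  (((Num.sqrt k)%:C)%C *: H) *m ctr (((Num.sqrt k)%:C)%C *: H).
  rewrite ctrZ -scalemxAl -scalemxAr scalerA -rmorphM -expr2 sqr_sqrtr//.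
  exact: ltW.
apply: posdef_gram; rewrite /row_free mxrank_scale_nz//.
by rewrite eq_complex /= eqxx andbT sqrtr_eq0 -ltNge.
Qed.

Lemma rdet_gram_col_free r t (k s : R) (H : 'M[C]_(r, t)) :
  0 < k -> 0 < s -> (t <= r)%N -> row_free (ctr H) ->
  s ^+ (r - t) * k ^+ t * rdet (ctr H *m H)
    <= rdet ((k%:C)%C *: (H *m ctr H) + (s%:C)%C%:M).
Proof.
move=> k0 s0 tr Hfree; rewrite -(ler_pM2r (exprn_gt0 t s0)).
rewrite (rdet_gram_mulC H (ltW k0) s0).
have -> : s ^+ (r - t) * k ^+ t * rdet (ctr H *m H) * s ^+ t =
    s ^+ r * (k ^+ t * rdet (ctr H *m H)).
  by rewrite (_ : s ^+ r = s ^+ (r - t) * s ^+ t); [ring|rewrite -exprD subnK].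
rewrite ler_pM2l ?exprn_gt0//.
by have := rdet_gram_row_free k0 s0 Hfree; rewrite ctrK.
Qed.

Lemma rank_ctr r t (H : 'M[C]_(r, t)) : \rank (ctr H) = \rank H.
Proof. by rewrite /ctr mxrank_map mxrank_tr. Qed.

End DeterminantBounds.

(** * Integration and measurability *)

Section IntegralBounds.
Local Open Scope ereal_scope.
Context d (T : measurableType d) (R : realType) (mu : {measure set T -> \bar R}).
Implicit Types f g n : T -> \bar R.

(* [f] and [g] need not be measurable: the integral of a nonnegative function
   is a supremum over the simple functions below it. *)
Lemma le_integral_pointwise f g : (forall x, f x <= g x) ->
  \int[mu]_x f x <= \int[mu]_x g x.
Proof.
have mono p q : (forall x, 0 <= p x) -> (forall x, p x <= q x) ->
    \int[mu]_x p x <= \int[mu]_x q x.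
  move=> p0 pq; have q0 x : 0 <= q x by exact: le_trans (p0 x) (pq x).
  rewrite !ge0_integralTE//; apply: le_ereal_sup => _ [s /= sp <-].
  exists s => // x.
  exact: le_trans (sp x) (pq x).
move=> fg; rewrite integralE [leRHS]integralE; apply: leeB.
- apply: mono => x; first exact: funepos_ge0.
  by apply: (@funepos_le _ _ setT) => //; rewrite inE.
- apply: mono => x; first exact: funeneg_ge0.
  by apply: (@funeneg_le _ _ setT) => //; rewrite inE.
Qed.

Hypothesis mu1 : mu setT = 1.

Lemma integral_prob_cst (a : R) : \int[mu]_x a%:E = a%:E.
Proof. by rewrite integral_cst// mu1 mule1. Qed.

Lemma ge0_integrable n : measurable_fun setT n -> (forall x, 0 <= n x) ->
  \int[mu]_x n x < +oo -> mu.-integrable setT n.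
Proof.
move=> mn n0 noo; apply/integrableP; split => //.
by under eq_integral do rewrite gee0_abs//.
Qed.

Lemma integrable_prob_cst (a : R) : mu.-integrable setT (cst a%:E).
Proof.
apply/integrableP; split => //.
by rewrite (_ : (fun _ => _) = cst `|a|%:E) ?integral_prob_cst ?ltry//.
Qed.

(** Serves for both the inner integral over [kappa h] and the outer one over [mu]. If [n] has
    infinite integral, positivity of [c] makes the right side [+oo]. *)
Lemma integral_le_affine f n (a c : R) : measurable_fun setT n ->
  (forall x, 0 <= n x) -> (0 < c)%R -> (forall x, f x <= a%:E + c%:E * n x) ->
  \int[mu]_x f x <= a%:E + c%:E * \int[mu]_x n x.
Proof.
move=> mn n0 c0 fle; have [noo|] := ltP (\int[mu]_x n x) +oo; last first.
  by rewrite leye_eq => /eqP ->; rewrite gt0_muley ?lte_fin// addey ?leey.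
have ni := ge0_integrable mn n0 noo.
apply: (le_trans (le_integral_pointwise fle)).
rewrite integralD//; [|exact: integrable_prob_cst|exact: integrableZl].
by rewrite integral_prob_cst integralZl.
Qed.

Lemma integral_ge_sub f n (a : R) : measurable_fun setT n ->
  (forall x, 0 <= n x) -> (forall x, a%:E - n x <= f x) ->
  a%:E - \int[mu]_x n x <= \int[mu]_x f x.
Proof.
move=> mn n0 lef; have [noo|] := ltP (\int[mu]_x n x) +oo; last first.
  by rewrite leye_eq => /eqP ->; rewrite addeNy leNye.
have ni := ge0_integrable mn n0 noo.
apply: le_trans (le_integral_pointwise lef).
by rewrite integralB//; [rewrite integral_prob_cst|exact: integrable_prob_cst].
Qed.

End IntegralBounds.

(** * Measurability of complex matrix expressions *)

Section ComplexMeasurability.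
Context d (T : measurableType d) (R : realType).
Local Notation C := R[i].

Definition measurable_cfun (f : T -> C) : Prop :=
  measurable_fun setT (fun w => complex.Re (f w)) /\
  measurable_fun setT (fun w => complex.Im (f w)).

Lemma measurable_cfun_cst (z : C) : measurable_cfun (fun=> z).
Proof. by split; exact: measurable_cst. Qed.

Lemma measurable_cfunD f g : measurable_cfun f -> measurable_cfun g ->
  measurable_cfun (fun w => f w + g w).
Proof.
move=> [f1 f2] [g1 g2]; split.
  by apply: (eq_measurable_fun _ _ (measurable_funD f1 g1)) => w _; rewrite raddfD.
by apply: (eq_measurable_fun _ _ (measurable_funD f2 g2)) => w _; rewrite raddfD.
Qed.

Lemma measurable_cfunM f g : measurable_cfun f -> measurable_cfun g ->
  measurable_cfun (fun w => f w * g w).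
Proof.
move=> [f1 f2] [g1 g2]; split.
  apply: (eq_measurable_fun _ _ (measurable_funB (measurable_funM f1 g1)
    (measurable_funM f2 g2))) => w _ /=.
  by case: (f w) => ? ?; case: (g w).
apply: (eq_measurable_fun _ _ (measurable_funD (measurable_funM f1 g2)
  (measurable_funM f2 g1))) => w _ /=.
by case: (f w) => ? ?; case: (g w).
Qed.

Lemma measurable_cfun_conj f : measurable_cfun f ->
  measurable_cfun (fun w => conjc (f w)).
Proof.
move=> [f1 f2]; split.
  by apply: (eq_measurable_fun _ _ f1) => w _; case: (f w).
have mN : measurable_fun setT (fun w => - complex.Im (f w)).
  exact: measurableT_comp.
by apply: (eq_measurable_fun _ _ mN) => w _; case: (f w).
Qed.

Lemma measurable_cfun_sum (I : Type) (s : seq I) (f : I -> T -> C) :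
  (forall i, measurable_cfun (f i)) ->
  measurable_cfun (fun w => \sum_(i <- s) f i w).
Proof.
move=> mf; elim: s => [|i s ih].
  by under eq_fun do rewrite big_nil; exact: measurable_cfun_cst.
by under eq_fun do rewrite big_cons; exact: measurable_cfunD.
Qed.

Lemma measurable_cfun_prod (I : Type) (s : seq I) (f : I -> T -> C) :
  (forall i, measurable_cfun (f i)) ->
  measurable_cfun (fun w => \prod_(i <- s) f i w).
Proof.
move=> mf; elim: s => [|i s ih].
  by under eq_fun do rewrite big_nil; exact: measurable_cfun_cst.
by under eq_fun do rewrite big_cons; exact: measurable_cfunM.
Qed.

Lemma measurable_cmxM m n p (A : T -> 'M[C]_(m, n)) (B : T -> 'M[C]_(n, p)) :
  measurable_cmx A -> measurable_cmx B ->
  measurable_cmx (fun w => A w *m B w).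
Proof.
move=> mA mB i j; change (measurable_cfun (fun w => (A w *m B w) i j)).
under eq_fun do rewrite mxE.
by apply: measurable_cfun_sum => k; apply: measurable_cfunM; [exact: mA|exact: mB].
Qed.

Lemma measurable_cmx_ctr m n (A : T -> 'M[C]_(m, n)) :
  measurable_cmx A -> measurable_cmx (fun w => ctr (A w)).
Proof.
move=> mA i j; change (measurable_cfun (fun w => ctr (A w) i j)).
by under eq_fun do rewrite !mxE; exact/measurable_cfun_conj/mA.
Qed.

Lemma measurable_rdet n (A : T -> 'M[C]_n) :
  measurable_cmx A -> measurable_fun setT (fun w => rdet (A w)).
Proof.
move=> mA; have [] // : measurable_cfun (fun w => \det (A w)).
(* By the Leibniz formula the determinant is a finite sum of signed products of entries. *)
apply: measurable_cfun_sum => s; apply: measurable_cfunM.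
  exact: measurable_cfun_cst.
by apply: measurable_cfun_prod => i; exact: mA.
Qed.

Lemma measurable_normF2 m n (A : T -> 'M[C]_(m, n)) :
  measurable_cmx A -> measurable_fun setT (fun w => normF2 (A w)).
Proof.
move=> mA; apply: measurable_sum => i; apply: measurable_sum => j.
have [A1 A2] := mA i j.
by apply: measurable_funD; exact: measurable_funX.
Qed.

End ComplexMeasurability.

(** * Bounds on the rate *)

Section GramDeterminant.
Variable R : realType.
Local Notation C := R[i].

(** The determinant of the Gram matrix of the smaller size, which is nonsingular at full rank; it
    merges the two logarithmic moment conditions into one. *)
Definition gramdet r t (H : 'M[C]_(r, t)) : R :=
  if (t <= r)%N then rdet (ctr H *m H) else rdet (H *m ctr H).

Lemma rdet_gram_gt0_free m n (A : 'M[C]_(m, n)) :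
  0 < rdet (A *m ctr A) -> row_free A.
Proof.
move=> dA; have Au : A *m ctr A \in unitmx.
  rewrite unitmxE unitfE; apply: contraTneq dA => d0.
  by rewrite /rdet d0 ltxx.
(* The right inverse is the Moore-Penrose one. *)
by apply/row_freeP; exists (ctr A *m invmx (A *m ctr A)); rewrite mulmxA mulmxV.
Qed.

Lemma gramdet_gt0 r t (H : 'M[C]_(r, t)) : \rank H = minn r t -> 0 < gramdet H.
Proof.
rewrite /gramdet; case: leqP => tr rkH.
  have := posdef_gram (G := ctr H); rewrite ctrK => /(_ _)/posdef_detE[]//.
  by rewrite /row_free rank_ctr rkH.
by have /posdef_detE[] := posdef_gram (G := H) (introT eqP rkH).
Qed.

Lemma gramdet_bound r t (k s : R) (H : 'M[C]_(r, t)) : 0 < k -> 0 < s ->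
  0 < gramdet H ->
  s ^+ (r - minn t r) * k ^+ minn t r * gramdet H
    <= rdet ((k%:C)%C *: (H *m ctr H) + (s%:C)%C%:M).
Proof.
rewrite /gramdet => k0 s0; case: leqP => tr d0.
  apply: rdet_gram_col_free => //; apply: rdet_gram_gt0_free.
  by rewrite ctrK.
rewrite subnn expr0 mul1r; apply: rdet_gram_row_free => //.
exact: rdet_gram_gt0_free.
Qed.

Lemma measurable_gramdet d (T : measurableType d) r t (H : T -> 'M[C]_(r, t)) :
  measurable_cmx H -> measurable_fun setT (fun w => gramdet (H w)).
Proof.
move=> mH; have mHc := measurable_cmx_ctr mH.
rewrite /gramdet; case: leqP => _; apply: measurable_rdet; exact: measurable_cmxM.
Qed.

Lemma real_scalar_mxD n (a b : R) :
  ((a + b)%:C)%C%:M = (a%:C)%C%:M + (b%:C)%C%:M :> 'M[C]_n.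
Proof. by rewrite rmorphD raddfD. Qed.

Lemma real_scalar_mxM n (a b : R) :
  ((a * b)%:C)%C%:M = (a%:C)%C *: (b%:C)%C%:M :> 'M[C]_n.
Proof. by rewrite rmorphM scale_scalar_mx. Qed.

Lemma psd_le_scalar n (A : 'M[C]_n) : psd A ->
  exists2 c : R, 0 <= c & psd ((c%:C)%C%:M - A).
Proof. by move=> /psd_le_trace[pA c0]; exists (complex.Re (\tr A)). Qed.

Lemma posdef_le_scalar n (A : 'M[C]_n) : posdef A ->
  exists2 s : R, 0 < s & psd ((s%:C)%C%:M - A).
Proof.
move=> /posdef_psd/psd_le_trace[pA c0].
exists (complex.Re (\tr A) + 1); first by rewrite ltr_wpDl.
by rewrite real_scalar_mxD addrAC; apply: psdD pA (psd_scalar _ ler01).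
Qed.

End GramDeterminant.

Section RateBounds.
Variables (R : realType) (r t : nat).
Local Notation C := R[i].
Local Notation m := (minn t r).
Implicit Types (SX W : 'M[C]_t) (SZ : 'M[C]_r) (H : 'M[C]_(r, t)).

(** The term [ln (rdet SX)] is kept apart because it cancels against the one in [logdet_Mblk_ge];
    what remains does not depend on [SX]. *)
Lemma ln_received_le (P c0 s : R) SX (SS' : 'M[C]_t) SZ H :
  1 <= P -> 0 <= c0 -> 0 < s -> posdef SX -> complex.Re (\tr SX) <= P ->
  psd SS' -> psd ((c0%:C)%C%:M - SS') -> posdef SZ -> psd ((s%:C)%C%:M - SZ) ->
  ln (rdet SX * rdet (H *m (SX + SigS SS' P) *m ctr H + SZ)) <=
    ln (rdet SX) + (ln P *+ m + ln s *+ r)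
    + (1 + c0) / s *+ m * normF2 H.
Proof.
move=> P1 c00 s0 pX trX pS cS pZ sZ.
have P0 : 0 < P by exact: lt_le_trans P1.
have [dX _] := posdef_detE pX.
have pK : psd (SX + SigS SS' P).
  by apply: psdD (posdef_psd pX) (psdZ (ltW P0) pS).
have [dY _] := posdef_detE (received_posdef H pK pZ).
rewrite lnM ?posrE// -addrA lerD2l.
have k0 : 0 <= P * (1 + c0) by rewrite mulr_ge0// ?addr_ge0// ltW.
(* [SX] is at most its trace times the identity, hence at most [P], and the interference is at most
   [P * c0]. *)
have kK : psd (((P * (1 + c0))%:C)%C%:M - (SX + SigS SS' P)).
  have -> : P * (1 + c0) =
    complex.Re (\tr SX) + (P - complex.Re (\tr SX)) + P * c0 by ring.
  rewrite real_scalar_mxD real_scalar_mxM opprD addrACA -scalerBr.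
  rewrite real_scalar_mxD [X in psd (X + _)]addrAC.
  apply: psdD; last exact: psdZ (ltW P0) cS.
  apply: psdD; last by apply: psd_scalar; rewrite subr_ge0.
  by have [] := psd_le_trace (posdef_psd pX).
have n0 := normF2_ge0 H; set n := normF2 H in n0 *.
have le1 := received_rdet_le H k0 s0 pK pZ kK sZ; rewrite -/n in le1.
have kns : 0 < P * (1 + c0) * n + s by rewrite ltr_wpDl// mulr_ge0.
apply: (@le_trans _ _ (ln (s ^+ (r - m) * (P * (1 + c0) * n + s) ^+ m))).
  by rewrite ler_ln ?posrE// mulr_gt0// exprn_gt0.
rewrite lnM ?posrE ?exprn_gt0// !lnXn//.
(* Since [1 <= P], [s] may be enlarged to [P * s]; factoring out [P * s] leaves a term of the form
   ln(1 + x), which is at most x. *)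
have le2 : ln (P * (1 + c0) * n + s) <= ln P + ln s + (1 + c0) / s * n.
  have u0 : 0 <= (1 + c0) / s * n.
    by rewrite mulr_ge0// divr_ge0 ?addr_ge0// ltW.
  have u1 : 0 < 1 + (1 + c0) / s * n by rewrite ltr_pwDl.
  have -> : ln P + ln s = ln (P * s) by rewrite lnM.
  apply: (@le_trans _ _ (ln (P * s * (1 + (1 + c0) / s * n)))).
    rewrite ler_ln ?posrE// ?mulr_gt0//.
    have -> : P * s * (1 + (1 + c0) / s * n) = P * (1 + c0) * n + P * s.
      by field; rewrite gt_eqF.
    by rewrite lerD2l ler_peMl// ltW.
  rewrite lnM ?posrE// ?mulr_gt0// lerD2l le_ln1Dx//.
  by rewrite (lt_le_trans _ u0)// ltrN10.
have := lerMn2r m (ln (P * (1 + c0) * n + s)) (ln P + ln s + (1 + c0) / s * n).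
rewrite le2 orbT => le3.
have -> : ln s *+ r = ln s *+ (r - m) + ln s *+ m.
  by rewrite -mulrnDr subnK// geq_minr.
rewrite !mulrnDl in le3; rewrite mulrnAl; lra.
Qed.

Lemma logdet_Mblk_ge (P : R) SX (SS' : 'M[C]_t) SZ W H :
  0 <= P -> posdef SX -> psd SS' -> posdef SZ ->
  ln (rdet SX) + ln (rdet SZ) <= logdet (Mblk SX (SigS SS' P) W SZ H).
Proof.
move=> P0 pX pS pZ; have [dX _] := posdef_detE pX; have [dZ _] := posdef_detE pZ.
have le1 := Mblk_rdet_ge W H pX (psdZ P0 pS) pZ.
rewrite -lnM// /logdet ler_ln ?posrE ?mulr_gt0//.
by apply: lt_le_trans le1; rewrite mulr_gt0.
Qed.

Lemma ln_received_ge (P s : R) SX (SS' : 'M[C]_t) SZ H : (0 < t)%N ->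
  0 < P -> 0 < s -> psd SS' -> posdef SZ -> psd (SZ - (s%:C)%C%:M) ->
  0 < gramdet H ->
  SX = ((P / t%:R)%:C)%C%:M ->
  ln (rdet SX) + (ln s *+ (r - m) + ln P *+ m - ln t%:R *+ m)
    + ln (gramdet H)
  <= ln (rdet SX * rdet (H *m (SX + SigS SS' P) *m ctr H + SZ)).
Proof.
move=> t0 P0 s0 pS pZ sZ dH SXE.
have t0' : 0 < t%:R :> R by rewrite ltr0n.
have k0 : 0 < P / t%:R by rewrite divr_gt0.
have pX : posdef SX by rewrite SXE; exact: posdef_scalar.
have [dX _] := posdef_detE pX.
have pPS := psdZ (ltW P0) pS.
have [dY _] := posdef_detE (received_posdef H (psdD (posdef_psd pX) pPS) pZ).
rewrite lnM// -addrA lerD2l.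
have kK : psd (SX + SigS SS' P - ((P / t%:R)%:C)%C%:M).
  by rewrite -SXE addrAC subrr add0r.
have le1 := le_trans (gramdet_bound k0 s0 dH) (received_rdet_ge H (ltW k0) s0 kK sZ).
have y0 : 0 < s ^+ (r - m) * (P / t%:R) ^+ m by rewrite mulr_gt0// exprn_gt0.
apply: (@le_trans _ _ (ln (s ^+ (r - m) * (P / t%:R) ^+ m * gramdet H))).
  rewrite !lnM ?posrE ?exprn_gt0// !lnXn// ln_div ?posrE// mulrnBl addrA.
  exact: lexx.
by rewrite ler_ln ?posrE// mulr_gt0.
Qed.

(** Signal and interference both scale with [P], so the determinant of their sum is a constant times
    [P ^+ t], that is, a constant times [rdet SX]: the excess over [ln (rdet SX)] depends on neither
    [P] nor [H]. *)
Lemma logdet_Mblk1 (P : R) SX (SS' : 'M[C]_t) SZ H : (0 < t)%N ->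
  0 < P -> psd SS' -> posdef SZ ->
  SX = ((P / t%:R)%:C)%C%:M ->
  logdet (Mblk SX (SigS SS' P) 1%:M SZ H) =
  ln (rdet SX) + ln t%:R *+ t + ln (rdet (((t%:R^-1)%:C)%C%:M + SS')) + ln (rdet SZ).
Proof.
move=> t0 P0 pS pZ SXE; have [dZ _] := posdef_detE pZ.
have t0' : 0 < t%:R :> R by rewrite ltr0n.
have k0 : 0 < P / t%:R by rewrite divr_gt0.
have pX : posdef SX by rewrite SXE; exact: posdef_scalar.
have pK0 : posdef (((t%:R^-1)%:C)%C%:M + SS').
  by apply: posdefD pS; apply: posdef_scalar; rewrite invr_gt0.
have [dK0 _] := posdef_detE pK0.
have pPS := psdZ (ltW P0) pS.
have KE : SX + SigS SS' P = (P%:C)%C *: (((t%:R^-1)%:C)%C%:M + SS').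
  by rewrite SXE scalerDr -real_scalar_mxM.
rewrite /logdet Mblk1_rdet//; last exact: posdefD pPS.
rewrite KE rdetZ SXE rdet_scalar !lnM ?posrE ?mulr_gt0 ?exprn_gt0//.
by rewrite !lnXn// ln_div ?posrE// mulrnBl subrK.
Qed.

End RateBounds.

(** * Upper and lower bounds on R(P) up to an additive constant *)

Section RateLimit.
Local Open Scope ereal_scope.
Context (R : realType) (dT dO : measure_display)
  (T : measurableType dT) (Omega : measurableType dO)
  (mu : probability T R) (kappa : R.-pker T ~> Omega)
  (t r : nat) (H : Omega -> 'M[R[i]]_(r, t))
  (SZ : 'M[R[i]]_r) (SS' : 'M[R[i]]_t).
Hypotheses (t_gt0 : (0 < t)%N) (r_gt0 : (0 < r)%N) (mH : measurable_cmx H).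
Hypothesis pZ : posdef SZ.
Hypothesis pS : psd SS'.
Local Notation m := (minn t r).

Lemma measurable_kernel_integral (n : Omega -> \bar R) :
  measurable_fun setT n -> (forall w, 0 <= n w) ->
  measurable_fun setT (fun h => \int[kappa h]_w n w).
Proof.
move=> mn n0; apply: measurable_fun_integral_kernel => // U mU.
exact: measurable_kernel.
Qed.

Lemma rateP_le : \int[mu]_h \int[kappa h]_w (normF2 (H w))%:E < +oo ->
  exists C : R, forall P : R, (1 <= P)%R ->
    rateP mu kappa H SZ SS' P <= (ln P *+ m + C)%:E.
Proof.
move=> EN; have [c0 c00 cS] := psd_le_scalar pS.
have [s s0 sZ] := posdef_le_scalar pZ.
pose c := ((1 + c0) / s *+ m)%R.
have m0 : (0 < m)%N by rewrite leq_min t_gt0.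
have cgt0 : (0 < c)%R by rewrite pmulrn_lgt0// divr_gt0// ltr_pwDl.
pose n w := (normF2 (H w))%:E : \bar R.
have n0 w : 0 <= n w by rewrite lee_fin normF2_ge0.
have mn : measurable_fun setT n.
  by apply: measurableT_comp => //; exact: measurable_normF2.
pose N h := \int[kappa h]_w n w.
have N0 h : 0 <= N h by exact: integral_ge0.
have mN : measurable_fun setT N by exact: measurable_kernel_integral.
have ENfin : \int[mu]_h N h \is a fin_num.
  by rewrite ge0_fin_numE//; exact: integral_ge0.
pose b := (ln s *+ r - ln (rdet SZ))%R.
exists (b + c * fine (\int[mu]_h N h))%R => P P1.
have P0 : (0 <= P)%R by exact: le_trans P1.
apply: ge_ereal_sup => _ [SX [pX trX] <-].
rewrite addrA EFinD EFinM fineK//.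
(* It remains to bound the integrand at each [h]: from above on the first term, and from below,
   uniformly in [W], on the infimum. *)
apply: integral_le_affine => //; first exact: probability_setT.
move=> h; set I1 := \int[kappa h]_w _; set I2 := ereal_inf _.
have le1 : I1 <= (ln (rdet SX) + (ln P *+ m + ln s *+ r))%:E + c%:E * N h.
  apply: integral_le_affine => //; first exact: prob_kernel.
  move=> w; rewrite /n -EFinM -EFinD lee_fin.
  exact: ln_received_le.
have le2 : (ln (rdet SX) + ln (rdet SZ))%:E <= I2.
  apply: le_ereal_inf_tmp => _ [W _ <-].
  rewrite -(integral_prob_cst (mu := kappa h)) ?prob_kernel//.
  apply: le_integral_pointwise => w; rewrite lee_fin.
  exact: logdet_Mblk_ge.
apply: (le_trans (leeB le1 le2)); rewrite addeAC -EFinB.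
by apply: leeD => //; rewrite lee_fin /b; lra.
Qed.

(* [ln] is 0 on nonpositive reals, so rank-deficient channels are sent to +oo
   separately; the lower bound on the integrand then holds everywhere. *)
Definition loggram (w : Omega) : \bar R :=
  if (0 < gramdet (H w))%R then `|ln (gramdet (H w))|%:E else +oo.

Lemma loggram_ge0 w : 0 <= loggram w.
Proof. by rewrite /loggram; case: ifP. Qed.

Lemma measurable_abs_ln_gramdet :
  measurable_fun setT (fun w => `|ln (gramdet (H w))|%:E : \bar R).
Proof.
do 2 apply: measurableT_comp => //.
by apply: measurableT_comp; [exact: measurable_ln|exact: measurable_gramdet].
Qed.

Lemma measurable_loggram : measurable_fun setT loggram.
Proof.
apply: measurable_fun_ifT; last exact: measurable_cst.
  by apply: measurable_fun_ltr => //; exact: measurable_gramdet.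
exact: measurable_abs_ln_gramdet.
Qed.

(** Full rank makes [gramdet] positive, so the value [+oo] is taken only on a [kappa h]-null set,
    for [mu]-almost every [h]. *)
Lemma integral_loggram :
  {ae mu, forall h, {ae kappa h, forall w, \rank (H w) = minn r t}} ->
  \int[mu]_h \int[kappa h]_w loggram w =
  \int[mu]_h \int[kappa h]_w `|ln (gramdet (H w))|%:E.
Proof.
move=> rkH; apply: ge0_ae_eq_integral => //.
- exact: measurable_kernel_integral measurable_loggram loggram_ge0.
- exact: measurable_kernel_integral measurable_abs_ln_gramdet _.
- by move=> h _; apply: integral_ge0 => w _; exact: loggram_ge0.
- by move=> h _; exact: integral_ge0.
apply: filterS rkH => h rkH _; apply: ge0_ae_eq_integral => //.
- exact: measurable_loggram.
- exact: measurable_abs_ln_gramdet.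
- by move=> w _; exact: loggram_ge0.
by apply: filterS rkH => w rkH _; rewrite /loggram gramdet_gt0.
Qed.

Lemma rateP_ge :
  {ae mu, forall h, {ae kappa h, forall w, \rank (H w) = minn r t}} ->
  \int[mu]_h \int[kappa h]_w `|ln (gramdet (H w))|%:E < +oo ->
  exists C : R, forall P : R, (1 <= P)%R ->
    (ln P *+ m + C)%:E <= rateP mu kappa H SZ SS' P.
Proof.
move=> rkH EN; have [s s0 sZ] := posdef_ge_scalar pZ.
pose N h := \int[kappa h]_w loggram w.
have N0 h : 0 <= N h by apply: integral_ge0 => w _; exact: loggram_ge0.
have mN : measurable_fun setT N.
  exact: measurable_kernel_integral measurable_loggram loggram_ge0.
have ENfin : \int[mu]_h N h \is a fin_num.
  rewrite ge0_fin_numE; first by rewrite /N integral_loggram.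
  exact: integral_ge0.
have t0 : (0 < t%:R :> R)%R by rewrite ltr0n.
pose b := (ln s *+ (r - m) - ln t%:R *+ m - ln t%:R *+ t
  - ln (rdet (((t%:R^-1)%:C)%C%:M + SS')) - ln (rdet SZ))%R.
exists (b - fine (\int[mu]_h N h))%R => P P1.
have P0 : (0 < P)%R by exact: lt_le_trans P1.
(* Uniform power allocation, which meets the trace constraint with equality. *)
pose SX : 'M[R[i]]_t := ((P / t%:R)%:C)%C%:M.
have pX : posdef SX by apply: posdef_scalar; rewrite divr_gt0.
apply: (@le_trans _ _ (rateX mu kappa H SZ SS' P SX)); last first.
  apply: ereal_sup_ubound; exists SX => //; split => //.
  rewrite /SX mxtrace_scalar -rmorphMn /= -mulr_natr divfK//.
  by rewrite gt_eqF.
rewrite addrA EFinB fineK//.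
apply: integral_ge_sub => //; first exact: probability_setT.
move=> h; set I1 := \int[kappa h]_w _; set I2 := ereal_inf _.
have le1 : (ln (rdet SX) + (ln s *+ (r - m) + ln P *+ m - ln t%:R *+ m))%:E
    - N h <= I1.
  apply: integral_ge_sub; first exact: prob_kernel.
  - exact: measurable_loggram.
  - exact: loggram_ge0.
  (* Where [gramdet] is not positive the left side is [-oo]. *)
  move=> w; rewrite /loggram; case: ifPn => [d0|_]; last by rewrite addeNy leNye.
  rewrite -EFinB lee_fin.
  apply: le_trans (ln_received_ge t_gt0 P0 s0 pS pZ sZ d0 erefl).
  by rewrite lerD2l lerNl ler_normr lexx orbT.
have le2 : I2 <= (ln (rdet SX) + ln t%:R *+ t
    + ln (rdet (((t%:R^-1)%:C)%C%:M + SS')) + ln (rdet SZ))%:E.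
  (* The infimum is at most its value at [W = 1], where the integrand is constant in [w]. *)
  apply: ge_ereal_inf; exists (\int[kappa h]_w (logdet (Mblk SX (SigS SS' P) 1%:M SZ (H w)))%:E).
    by exists 1%:M.
  rewrite -(integral_prob_cst (mu := kappa h)) ?prob_kernel//.
  apply: le_integral_pointwise => w; rewrite lee_fin.
  by rewrite (logdet_Mblk1 _ t_gt0 P0 pS pZ erefl).
apply: le_trans (leeB le1 le2); rewrite addeAC -EFinB.
by apply: leeD => //; rewrite lee_fin /b; lra.
Qed.

End RateLimit.

(** * The limit at high SNR *)

Lemma cvg_ln_pinfty (R : realType) : ln x @[x --> (+oo : set_system R)] --> +oo.
Proof.
apply/cvgryPge => A; near=> x.
have x0 : expR A <= x by near: x; exact: nbhs_pinfty_ge.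
by rewrite -[A]expRK ler_ln ?posrE ?expR_gt0// (lt_le_trans (expR_gt0 A)).
Unshelve. all: by end_near. Qed.

Lemma cvg_log_affine (R : realType) (C z : R) (k : nat) : 0 < z ->
  ((ln P *+ k + C) * (ln (P / z))^-1)%:E @[P --> (+oo : set_system R)]
    --> (k%:R)%:E.
Proof.
move=> z0; have cvgq : ln (P / z) @[P --> (+oo : set_system R)] --> +oo.
  apply: (cvg_comp (fun P => P / z) (@ln R)) (@cvg_ln_pinfty R).
  by apply: gt0_cvgMly => //; rewrite invr_gt0.
have /cvgryPgt/(_ 0) q0 := cvgq.
have cvgV : (ln (P / z))^-1 @[P --> (+oo : set_system R)] --> 0.
  apply/(cvgrVy _).
    by near=> P; rewrite invr_gt0; near: P.
  by apply: cvg_trans cvgq; apply: near_eq_cvg; near=> P; rewrite /= invrK.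
apply: cvg_EFin; first by near=> P.
(* Writing [ln P] as [ln (P / z) + ln z] makes the quotient [k] plus a constant over
   [ln (P / z)]. *)
rewrite -[k%:R]addr0 -(mulr0 (ln z *+ k + C)).
have : k%:R + (ln z *+ k + C) * (ln (P / z))^-1 @[P --> (+oo : set_system R)]
   --> k%:R + (ln z *+ k + C) * 0.
  by apply: cvgD; [exact: cvg_cst|apply: cvgM => //; exact: cvg_cst].
apply: cvg_trans; apply: near_eq_cvg; near=> P.
have P0 : 0 < P by near: P; exact: nbhs_pinfty_gt.
have qP : 0 < ln (P / z) by near: P.
rewrite /=; have -> : ln P = ln (P / z) + ln z by rewrite ln_div ?posrE// subrK.
rewrite mulrnDl -!(mulr_natl (ln _)); field.
by rewrite gt_eqF.
Unshelve. all: by end_near. Qed.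

Unset Implicit Arguments.

Theorem theorem1 (R : realType) (dT dO : measure_display)
  (T : measurableType dT) (Omega : measurableType dO)
  (mu : probability T R) (kappa : R.-pker T ~> Omega)
  (t r : nat) (H : Omega -> 'M[R[i]]_(r, t))
  (SZ : 'M[R[i]]_r) (SS' : 'M[R[i]]_t) :
  (1 <= t)%N -> (1 <= r)%N ->
  measurable_cmx H ->
  {ae mu, forall h, {ae kappa h, forall w, \rank (H w) = minn r t}} ->
  (\int[mu]_h \int[kappa h]_w (normF2 (H w))%:E < +oo)%E ->
  ((t <= r)%N ->
     (\int[mu]_h \int[kappa h]_w (`|logdet (ctr (H w) *m H w)|)%:E < +oo)%E) ->
  ((r < t)%N ->
     (\int[mu]_h \int[kappa h]_w (`|logdet (H w *m ctr (H w))|)%:E < +oo)%E) ->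
  posdef SZ -> psd SS' ->
  ((rateP mu kappa H SZ SS' P * ((ln (P / rdet SZ))^-1)%:E)%E
     @[P --> +oo] --> ((minn t r)%:R)%:E).
Proof.
move=> t0 r0 mH rkH EF Etr Ert pZ pS; have [z0 _] := posdef_detE pZ.
have EN : (\int[mu]_h \int[kappa h]_w (`|ln (gramdet (H w))|)%:E < +oo)%E.
  by rewrite /gramdet; case: leqP => tr; [exact: Etr|exact: Ert].
have [C1 up] := rateP_le t0 r0 mH pZ pS EF.
have [C2 lo] := rateP_ge t0 mH pZ pS rkH EN.
apply: (squeeze_cvge _ (cvg_log_affine C2 z0)
  (cvg_log_affine C1 z0)).
near=> P; have P1 : 1 <= P by near: P; exact: nbhs_pinfty_ge.
(* Once [P] exceeds [rdet SZ] the normalizing factor is nonnegative, so multiplying by it preserves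
   both bounds. *)
have q0 : 0 <= (ln (P / rdet SZ))^-1.
  have zP : rdet SZ <= P by near: P; apply: nbhs_pinfty_ge; exact: num_real.
  by rewrite invr_ge0 ln_ge0// ler_pdivlMr// mul1r.
have q0' : (0 <= (ln (P / rdet SZ))^-1%:E)%E by rewrite lee_fin.
rewrite [X in (X <= _)%E && _]EFinM [X in _ && (_ <= X)%E]EFinM.
by apply/andP; split; apply: lee_wpmul2r => //; [exact: lo|exact: up].
Unshelve. all: by end_near. Qed.
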